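(* Let $(\mathcal M,\phi,\xi,\eta,g)$ be a Sasakian manifold and let $\alpha,\beta>0$ be real numbers. Then the image of $\mathcal M$ under the $\mathcal D_{\alpha,\beta}$-homothety, i.e. $\mathcal M$ equipped with the structure $(\phi,\xi',\eta',g')$ given by $$\xi'=\tfrac1\beta\xi,\qquad \eta'=\beta\eta,\qquad g'=\alpha g+(\beta^2-\alpha)\eta\otimes\eta,$$ is a $\frac{\beta}{\alpha}$-Sasakian manifold.
   Context: An almost contact metric structure $(\phi,\xi,\eta,g)$ on a connected manifold of dimension $2n+1\ge3$ satisfies $\phi^2X=-X+\eta(X)\xi$, $\eta(\xi)=1$, $g(\phi X,\phi Y)=g(X,Y)-\eta(X)\eta(Y)$. For a constant $c\neq0$ it is $c$-Sasakian if $(\nabla_X\phi)Y=c\,(g(X,Y)\xi-\eta(Y)X)$, where $\nabla$ is the Levi-Civita connection of $g$; Sasakian means $c=1$. *)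

(* Defs.v *)
From HB Require Import structures.
From mathcomp Require Import all_boot all_order all_algebra.
From mathcomp Require Import all_classical all_reals all_analysis.
From mathcomp Require Import ring.
Set Implicit Arguments.
Unset Strict Implicit.
Unset Printing Implicit Defensive.
Import Order.TTheory GRing.Theory Num.Theory.
Import numFieldNormedType.Exports.
Local Open Scope classical_set_scope.
Local Open Scope ring_scope.

(* C^k regularity on an open set U: the iterated directional derivatives of
   order at most k exist and are continuous on U. The values of f and of its
   derivatives outside U are irrelevant (lemma eq_C_k). *)
Fixpoint C_k (R : realType) (V W : normedModType R) (k : nat) (U : set V)
    (f : V -> W) : Prop :=
  (forall x, U x -> {for x, continuous f}) /\
  (if k is k'.+1 then
     forall v, (forall x, U x -> derivable f x v) /\ C_k k' U ('D_v f)
   else True).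

Definition C_infty (R : realType) (V W : normedModType R) (U : set V)
    (f : V -> W) : Prop := forall k, C_k k U f.

Section C_k_theory.
Variables (R : realType) (V : normedModType R) (U : set V).
Hypothesis oU : open U.

Lemma C_kW (W : normedModType R) k (f : V -> W) : C_k k.+1 U f -> C_k k U f.
Proof.
elim: k f => [|k IH] f [cf df]; split=> // v.
by have [dfv /IH] := df v.
Qed.

Lemma eq_C_k (W : normedModType R) k (f g : V -> W) :
  {in U, f =1 g} -> C_k k U f -> C_k k U g.
Proof.
have nearE (f' g' : V -> W) x : {in U, f' =1 g'} -> U x -> {near x, f' =1 g'}.
  move=> e Ux; apply: filterS (open_nbhs_nbhs (conj oU Ux)) => y Uy.
  by apply: e; exact: mem_set.
elim: k f g => [|k IH] f g e [cf df].
all: have cg x : U x -> {for x, continuous g}.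
1,3: move=> Ux; rewrite /prop_for /continuous_at -e ?inE//.
1,2: by apply: cvg_trans (cf x Ux); apply: near_eq_cvg; exact: nearE.
all: split=> // v; have [dfv Dfv] := df v; split.
  by move=> x Ux; apply: near_eq_derivable (dfv x Ux); exact: nearE.
apply: IH Dfv => x /set_mem Ux; apply: near_eq_derive.
exact: nearE.
Qed.

Lemma C_k_cst k (a : R) : C_k k U (cst a : V -> R).
Proof.
elim: k a => [|k IH] a; (split; first by move=> x _; exact: cvg_cst) => // v.
split=> [x _|]; first exact: derivable_cst.
by apply: eq_C_k (IH 0) => x _; rewrite derive_cst.
Qed.

Lemma C_kB k (f g : V -> R) : C_k k U f -> C_k k U g -> C_k k U (f - g).
Proof.
elim: k f g => [|k IH] f g [cf df] [cg dg].
all: split; first by move=> x Ux; apply: cvgB; [exact: cf|exact: cg].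
all: move=> // v; have [dfv Dfv] := df v; have [dgv Dgv] := dg v; split.
  by move=> x Ux; apply: derivableB; [exact: dfv|exact: dgv].
apply: eq_C_k (IH _ _ Dfv Dgv) => x /set_mem Ux.
by rewrite deriveB//; [exact: dfv|exact: dgv].
Qed.

Lemma C_kM k (f g : V -> R) : C_k k U f -> C_k k U g -> C_k k U (f * g).
Proof.
elim: k f g => [|k IH] f g Cf Cg.
  case: Cf Cg => [cf _] [cg _]; split=> // x Ux.
  by apply: cvgM; [exact: cf|exact: cg].
have [cf df] := Cf; have [cg dg] := Cg; split.
  by move=> x Ux; apply: cvgM; [exact: cf|exact: cg].
move=> v; have [dfv Dfv] := df v; have [dgv Dgv] := dg v; split.
  by move=> x Ux; apply: derivableM; [exact: dfv|exact: dgv].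
have Dgf := C_kB (C_k_cst k 0) (IH _ _ (C_kW Cg) Dfv).
apply: eq_C_k (C_kB (IH _ _ (C_kW Cf) Dgv) Dgf) => x /set_mem Ux.
rewrite deriveM; [|exact: dfv|exact: dgv].
have mulr_subN (a b c d : R) : a * b - (0 - c * d) = a * b + c * d by ring.
exact: mulr_subN.
Qed.

End C_k_theory.

(* A homeomorphism cmap, with inverse cinv, from the open set cdom onto an open
   subset of R^m. *)
Record chart (R : realType) (m : nat) (T : topologicalType) := Chart {
  cdom : set T;
  cmap : T -> 'rV[R]_m;
  cinv : 'rV[R]_m -> T;
  cdom_open : open cdom;
  cimg_open : open (cmap @` cdom);
  cmapK : {in cdom, cancel cmap cinv};
  cmap_continuous : forall p, cdom p -> {for p, continuous cmap};
  cinv_continuous : forall x, (cmap @` cdom) x -> {for x, continuous cinv} }.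

Arguments cdom_open {R m T} c : rename.
Arguments cimg_open {R m T} c : rename.

Record manifold (R : realType) (m : nat) := Manifold {
  mcarrier :> topologicalType;
  atlas : set (chart R m mcarrier);
  manifold_hausdorff : hausdorff_space mcarrier;
  manifold_second_countable : @second_countable mcarrier;
  atlas_cover : forall p : mcarrier, exists2 c, atlas c & cdom c p;
  atlas_compatible : forall c d, atlas c -> atlas d ->
    C_infty (cmap c @` (cdom c `&` cdom d)) (cmap d \o cinv c) }.

Section smooth_functions.
Context {R : realType} {m : nat} (M : manifold R m).

Definition is_smooth (f : M -> R) : Prop :=
  forall c, atlas c -> C_infty (cmap c @` cdom c) (f \o cinv c).

Record smooth_fun := SmoothFun {
  smooth_val :> M -> R;
  _ : smooth_val \in [pred f | `[< is_smooth f >]] }.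

HB.instance Definition _ := [isSub for smooth_val].
HB.instance Definition _ := [Choice of smooth_fun by <:].

Fact smooth_subring_closed : subring_closed [pred f | `[< is_smooth f >]].
Proof.
split=> [|f g|f g]; rewrite ?unfold_in /=.
- apply/asboolP => c _ k. exact: (C_k_cst (cimg_open c) k 1).
- move=> /asboolP sf /asboolP sg; apply/asboolP => c ac k.
  exact: (C_kB (cimg_open c) (sf c ac k) (sg c ac k)).
- move=> /asboolP sf /asboolP sg; apply/asboolP => c ac k.
  exact: (C_kM (cimg_open c) (sf c ac k) (sg c ac k)).
Qed.

HB.instance Definition _ := GRing.SubChoice_isSubComPzRing.Build (M -> R)
  [pred f | `[< is_smooth f >]] smooth_fun smooth_subring_closed.

Fact smooth_cst_subproof (a : R) :
  (cst a : M -> R) \in [pred f | `[< is_smooth f >]].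
Proof. by rewrite unfold_in /=; apply/asboolP => c _ k; exact: (C_k_cst (cimg_open c)). Qed.

Definition smooth_cst (a : R) : smooth_fun := SmoothFun (smooth_cst_subproof a).

End smooth_functions.

(* Vector fields are the derivations of the R-algebra C^oo(M), and tensor fields
   are the C^oo(M)-multilinear maps on vector fields. *)
Section vector_fields.
Context {R : realType} {m : nat} (M : manifold R m).
Local Notation C := (smooth_fun M).

Definition is_derivation (X : C -> C^o) : Prop :=
  (forall a f g, X (smooth_cst M a * f + g) = smooth_cst M a * X f + X g) /\
  (forall f g, X (f * g) = f * X g + g * X f).

Record vfield := VField {
  vfield_val :> C -> C^o;
  _ : vfield_val \in [pred X | `[< is_derivation X >]] }.

HB.instance Definition _ := [isSub for vfield_val].
HB.instance Definition _ := [Choice of vfield by <:].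

Fact vfield_submod_closed :
  submod_closed [pred X : C -> C^o | `[< is_derivation X >]].
Proof.
split=> [|h X Y]; rewrite ?unfold_in /=.
  by apply/asboolP; split=> *; rewrite /= !mulr0 addr0.
move=> /asboolP[XD XM] /asboolP[YD YM]; apply/asboolP; split=> [a f g|f g].
  rewrite -![(_ + _) _]/(h * X _ + Y _) XD YD; ring.
rewrite -![(_ + _) _]/(h * X _ + Y _) XM YM; ring.
Qed.

HB.instance Definition _ := GRing.SubChoice_isSubLmodule.Build C (C -> C^o)
  [pred X | `[< is_derivation X >]] vfield (GRing.submod_closed_semi vfield_submod_closed).

Lemma vfieldP (X : vfield) : is_derivation X.
Proof. by case: X => X /=; rewrite unfold_in /= => /asboolP. Qed.

Fact lie_subproof (X Y : vfield) :
  (fun f => X (Y f) - Y (X f)) \in [pred X | `[< is_derivation X >]].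
Proof.
have [[XD XM] [YD YM]] := (vfieldP X, vfieldP Y).
have XA f g : X (f + g) = X f + X g.
  by have := XD 1 f g; rewrite (_ : smooth_cst M 1 = 1) ?mul1r//; exact: val_inj.
have YA f g : Y (f + g) = Y f + Y g.
  by have := YD 1 f g; rewrite (_ : smooth_cst M 1 = 1) ?mul1r//; exact: val_inj.
rewrite unfold_in /=; apply/asboolP; split=> [a f g|f g].
  by rewrite YD XD XD YD; ring.
by rewrite XM YM XA YA !XM !YM; ring.
Qed.

(* The Lie bracket [X, Y]. *)
Definition lie (X Y : vfield) : vfield := VField (lie_subproof X Y).

(* X_p = 0 in the tangent space T_p M, that is, as a derivation at p. *)
Definition vanishes_at (X : vfield) (p : M) : Prop := forall f, X f p = 0.

Definition is_one_form (eta : vfield -> C^o) : Prop := linear eta.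

Definition is_riemannian_metric (g : vfield -> vfield -> C^o) : Prop :=
  [/\ forall X, linear (g X),
      forall X Y, g X Y = g Y X &
      forall X p, 0 <= g X X p /\ (g X X p = 0 <-> vanishes_at X p)].

Definition is_connection (D : vfield -> vfield -> vfield) : Prop :=
  [/\ forall f X Y Z, D (f *: X + Y) Z = f *: D X Z + D Y Z,
      forall X Y Z, D X (Y + Z) = D X Y + D X Z &
      forall f (X Y : vfield), D X (f *: Y) = X f *: Y + f *: D X Y].

Definition is_levi_civita (g : vfield -> vfield -> C^o)
    (D : vfield -> vfield -> vfield) : Prop :=
  [/\ is_connection D,
      forall X Y, D X Y - D Y X = lie X Y &
      forall X Y Z : vfield, X (g Y Z) = g (D X Y) Z + g Y (D X Z)].

Lemma levi_civita_unique g D D' : is_riemannian_metric g ->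
  is_levi_civita g D -> is_levi_civita g D' -> D = D'.
Proof.
move=> [gl gC gp] [_ tD mD] [_ tD' mD'].
apply/funext => X; apply/funext => Y; apply/subr0_eq.
pose A X Y := D X Y - D' X Y.
have AC U V : A U V = A V U.
  have e E : (forall X Y, E X Y - E Y X = lie X Y) -> E U V = E V U + lie U V.
    by move=> tE; rewrite -tE addrC subrK.
  by rewrite /A (e D)// (e D')// opprD addrACA subrr addr0.
have gB U V W : g U (V - W) = g U V - g U W.
  by rewrite -scaleN1r addrC gl addrC scaleN1r.
have AN U V W : g (A U V) W = - g V (A U W).
  rewrite gC !gB (gC W) (gC W); apply/eqP; rewrite -subr_eq0 opprK; apply/eqP.
  by have := mD U V W; rewrite mD' => e; rewrite addrACA -e; ring.
have A0 W : g (A X Y) W = - g (A X Y) W.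
  rewrite {1}AN [A X W]AC gC AN opprK [A W Y]AC gC AN.
  by rewrite [A Y X]AC gC.
apply: val_inj; apply/funext => f; apply: val_inj; apply/funext => p.
suff /(gp _ _).2 : g (A X Y) (A X Y) p = 0 by apply.
have /(congr1 (fun h : C => h p)) := A0 (A X Y).
by move=> /eqP; rewrite -addr_eq0 -mulr2n mulrn_eq0 => /eqP.
Qed.

Definition is_almost_contact_metric (phi : vfield -> vfield) (xi : vfield)
    (eta : vfield -> C^o) (g : vfield -> vfield -> C^o) : Prop :=
  [/\ linear phi, is_one_form eta & is_riemannian_metric g] /\
  [/\ forall X, phi (phi X) = - X + eta X *: xi,
      eta xi = 1 &
      forall X Y, g (phi X) (phi Y) = g X Y - eta X * eta Y].

(* nabla is the Levi-Civita connection of g (unique by levi_civita_unique);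
   (nabla_X phi) Y = nabla_X (phi Y) - phi (nabla_X Y). *)
Definition is_c_sasakian (c : R) (phi : vfield -> vfield) (xi : vfield)
    (eta : vfield -> C^o) (g : vfield -> vfield -> C^o) : Prop :=
  [/\ c != 0, is_almost_contact_metric phi xi eta g &
      exists2 nabla, is_levi_civita g nabla &
        forall X Y, nabla X (phi Y) - phi (nabla X Y) =
          smooth_cst M c *: (g X Y *: xi - eta Y *: X)].

Definition is_sasakian := is_c_sasakian 1.

End vector_fields.

(* Main.v *)
(* The Levi-Civita connection of g' is
   nabla'_X Y = nabla_X Y + k (eta(X) phi Y + eta(Y) phi X), k = 1 - beta^2 / alpha.
   The added tensor is symmetric and annihilated by eta. Since nabla_X xi = - phi X
   on a Sasakian manifold, X(eta Y) = eta(nabla_X Y) - g(Y, phi X), so nabla' is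
   metric for g' exactly when alpha k = alpha - beta^2; the formula for nabla' phi
   is then a direct computation. *)
Require Import Defs.
From mathcomp Require Import all_boot all_order all_algebra.
From mathcomp Require Import all_classical all_reals all_analysis.
From mathcomp Require Import ring.
Import Order.TTheory GRing.Theory Num.Theory.
Import numFieldNormedType.Exports.
Local Open Scope classical_set_scope.
Local Open Scope ring_scope.

Set Implicit Arguments.
Unset Strict Implicit.
Unset Printing Implicit Defensive.

(** * Consequences of the unbundled predicate [linear] *)

Section linear_maps.
Variables (A : pzRingType) (U V : lmodType A) (f : U -> V).
Hypothesis fL : linear f.

Lemma linear_mapD u v : f (u + v) = f u + f v.
Proof. by rewrite -{1}[u]scale1r fL scale1r. Qed.

Lemma linear_map0 : f 0 = 0.
Proof. by apply: (addrI (f 0)); rewrite -linear_mapD !addr0. Qed.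

Lemma linear_mapZ a u : f (a *: u) = a *: f u.
Proof. by rewrite -[a *: u]addr0 fL linear_map0 addr0. Qed.

Lemma linear_mapN u : f (- u) = - f u.
Proof. by rewrite -scaleN1r linear_mapZ scaleN1r. Qed.

End linear_maps.

(** * Smooth functions, and vector fields as derivations of them *)

Section smooth_functions.
Context {R : realType} {m : nat} {M : manifold R m}.
Local Notation C := (smooth_fun M).
Implicit Types (f h : C) (X Y : vfield M).

Lemma smooth_funP f h : (forall p, f p = h p) -> f = h.
Proof. by move=> fh; apply: val_inj; apply/funext. Qed.

Lemma smooth_cst1 : smooth_cst M 1 = 1.
Proof. exact: val_inj. Qed.

Lemma smooth_cstB (a b : R) : smooth_cst M (a - b) = smooth_cst M a - smooth_cst M b.
Proof. exact: val_inj. Qed.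

Lemma smooth_cstM (a b : R) : smooth_cst M (a * b) = smooth_cst M a * smooth_cst M b.
Proof. exact: val_inj. Qed.

Lemma smooth_addrr_eq0 f : f + f = 0 -> f = 0.
Proof.
move=> ff; apply: smooth_funP => p.
have /eqP : f p + f p = 0 by rewrite -[LHS]/((f + f) p) ff.
by rewrite -mulr2n mulrn_eq0 => /eqP.
Qed.

(** The smooth functions need not form an integral domain, but values are real, so the ring is
    reduced. *)
Lemma smooth_mulrr_eq0 f : f * f = 0 -> f = 0.
Proof.
move=> ff; apply: smooth_funP => p.
have /eqP : f p * f p = 0 by rewrite -[LHS]/((f * f) p) ff.
by rewrite mulf_eq0 orbb => /eqP.
Qed.

Lemma vfield_ext X Y : (forall f, X f = Y f) -> X = Y.
Proof. by move=> XY; apply: val_inj; apply/funext. Qed.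

(** Together with [vfield_ext], this turns an identity between vector fields into one between smooth
    functions, which [ring] can settle. *)
Lemma vfieldE :
  (forall X Y f, (X + Y) f = X f + Y f) * (forall X f, (- X) f = - X f) *
  (forall h X f, (h *: X) f = h * X f).
Proof. by []. Qed.

Lemma vfield_add X f h : X (f + h) = X f + X h.
Proof. by have [XD _] := vfieldP X; have := XD 1 f h; rewrite smooth_cst1 !mul1r. Qed.

Lemma vfield_mul X f h : X (f * h) = f * X h + h * X f.
Proof. by have [_] := vfieldP X; apply. Qed.

Lemma vfield_1 X : X 1 = 0.
Proof.
have := vfield_mul X 1 1; rewrite !mul1r => /esym/eqP.
by rewrite -subr_eq0 addrK => /eqP.
Qed.

Lemma vfield_cst X (a : R) : X (smooth_cst M a) = 0.
Proof.
have [XD _] := vfieldP X.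
have X0 : X 0 = 0 by apply: (addrI (X 0)); rewrite -vfield_add !addr0.
by have := XD a 1 0; rewrite X0 !addr0 vfield_1 mulr1 mulr0.
Qed.

End smooth_functions.

(** * Standard identities of an almost contact metric structure *)

Section almost_contact_metric.
Context {R : realType} {m : nat} {M : manifold R m}.
Variables (phi : vfield M -> vfield M) (xi : vfield M).
Variables (eta : vfield M -> smooth_fun M).
Variables (g : vfield M -> vfield M -> smooth_fun M).
Hypothesis acm : is_almost_contact_metric phi xi eta g.
Implicit Types X Y Z : vfield M.

Let phiL : linear phi. Proof. by case: acm => -[]. Qed.
Let etaL : is_one_form eta. Proof. by case: acm => -[]. Qed.
Let gR : is_riemannian_metric g. Proof. by case: acm => -[]. Qed.
Let phi2 X : phi (phi X) = - X + eta X *: xi. Proof. by case: acm => _ []. Qed.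
Let eta_xi : eta xi = 1. Proof. by case: acm => _ []. Qed.
Let g_phi X Y : g (phi X) (phi Y) = g X Y - eta X * eta Y.
Proof. by case: acm => _ []. Qed.

Lemma eta_add X Y : eta (X + Y) = eta X + eta Y.
Proof. exact: (linear_mapD etaL). Qed.

Lemma eta_opp X : eta (- X) = - eta X.
Proof. exact: (linear_mapN etaL). Qed.

Lemma eta_scale f X : eta (f *: X) = f * eta X.
Proof. exact: (linear_mapZ etaL). Qed.

Lemma metricC X Y : g X Y = g Y X.
Proof. by case: gR. Qed.

Lemma metric_addr X Y Z : g X (Y + Z) = g X Y + g X Z.
Proof. by case: gR => gL _ _; exact: (linear_mapD (gL X)). Qed.

Lemma metric_scaler f X Y : g X (f *: Y) = f * g X Y.
Proof. by case: gR => gL _ _; exact: (linear_mapZ (gL X)). Qed.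

Lemma metric_oppr X Y : g X (- Y) = - g X Y.
Proof. by case: gR => gL _ _; exact: (linear_mapN (gL X)). Qed.

Lemma metric_addl X Y Z : g (X + Y) Z = g X Z + g Y Z.
Proof. by rewrite metricC metric_addr !(metricC Z). Qed.

Lemma metric_scalel f X Y : g (f *: X) Y = f * g X Y.
Proof. by rewrite metricC metric_scaler (metricC Y). Qed.

Lemma metric_oppl X Y : g (- X) Y = - g X Y.
Proof. by rewrite metricC metric_oppr (metricC Y). Qed.

(** Since phi^2 xi = 0, the formula for phi^2 at phi xi gives phi xi = f xi with f = eta(phi xi).
    Then f^2 = eta(phi(f xi)) = eta(phi^2 xi) = 0, so f = 0. *)
Lemma phi_xi : phi xi = 0.
Proof.
have p2 : phi (phi xi) = 0 by rewrite phi2 eta_xi scale1r addNr.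
have pE : phi xi = eta (phi xi) *: xi.
  have := phi2 (phi xi); rewrite p2 (linear_map0 phiL) => /esym/eqP.
  by rewrite addrC subr_eq0 => /eqP/esym.
suff e0 : eta (phi xi) = 0 by rewrite pE e0 scale0r.
apply: smooth_mulrr_eq0.
by rewrite -eta_scale -(linear_mapZ phiL) -pE p2 (linear_map0 etaL).
Qed.

(** Computing phi^3 X as phi(phi^2 X) and as phi^2(phi X) and comparing leaves eta(phi X) xi = 0. *)
Lemma eta_phi X : eta (phi X) = 0.
Proof.
have : phi (phi (phi X)) = - phi X.
  by rewrite (phi2 X) (linear_mapD phiL) (linear_mapN phiL) (linear_mapZ phiL) phi_xi scaler0 addr0.
rewrite phi2 -[RHS]addr0 => /addrI /(congr1 eta).
by rewrite eta_scale eta_xi mulr1 (linear_map0 etaL).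
Qed.

Lemma metric_xi X : g X xi = eta X.
Proof.
apply/eqP; rewrite -subr_eq0 -[eta X]mulr1 -eta_xi -g_phi phi_xi.
by case: gR => gL _ _; rewrite (linear_map0 (gL _)).
Qed.

(** Compatibility of [g] with [phi] at (phi X, Y), with phi^2 X expanded; the [eta] terms die
    because eta(phi X) = eta(phi Y) = 0. *)
Lemma metric_phi_skew X Y : g (phi X) Y = - g X (phi Y).
Proof.
have := g_phi (phi X) Y; rewrite eta_phi mul0r subr0 => <-.
by rewrite phi2 metric_addl metric_oppl metric_scalel (metricC xi) metric_xi eta_phi mulr0 addr0.
Qed.

(** * The almost contact metric structure after the homothety *)

Section homothety.
Variables (a b : R).
Hypotheses (a0 : 0 < a) (b0 : 0 < b).

(** The coefficient b^2 - a may be negative, so positivity is read off from g'(X,X) = a g(phi X, phi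
    X) + b^2 eta(X)^2. This vanishes at a point exactly when both terms do, as does g(X,X) = g(phi
    X, phi X) + eta(X)^2. *)
Lemma homothety_riemannian_metric : is_riemannian_metric
  (fun X Y => smooth_cst M a * g X Y + smooth_cst M (b ^+ 2 - a) * (eta X * eta Y)).
Proof.
split=> [X f Y Z|X Y|X p].
- rewrite metric_addr metric_scaler eta_add eta_scale -[LHS]/(_ + _) -[RHS]/(f * _ + _); ring.
- by rewrite metricC (mulrC (eta X)).
have [_ _ gp] := gR.
have gX : g X X p = g (phi X) (phi X) p + eta X p ^+ 2.
  by rewrite -[RHS]/((g (phi X) (phi X) + eta X ^+ 2) p) g_phi; congr (smooth_val _ p); ring.
have g0 := (gp (phi X) p).1.
have -> : (smooth_cst M a * g X X + smooth_cst M (b ^+ 2 - a) * (eta X * eta X)) p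
    = a * g (phi X) (phi X) p + b ^+ 2 * eta X p ^+ 2.
  rewrite -[LHS]/(a * g X X p + (b ^+ 2 - a) * (eta X p * eta X p)) gX; ring.
have ag0 : 0 <= a * g (phi X) (phi X) p by rewrite mulr_ge0// ltW.
have be0 : 0 <= b ^+ 2 * eta X p ^+ 2 by rewrite mulr_ge0 ?sqr_ge0.
split; first exact: addr_ge0.
apply: iff_trans (gp X p).2; rewrite gX.
split=> /eqP; rewrite paddr_eq0 ?sqr_ge0// => /andP[/eqP u /eqP v].
  move: u v => /eqP; rewrite mulf_eq0 gt_eqF//= => /eqP-> /eqP.
  by rewrite mulf_eq0 expf_eq0/= gt_eqF//= => /eqP->; rewrite addr0.
by rewrite u v !mulr0 addr0.
Qed.

Lemma homothety_almost_contact_metric :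
  is_almost_contact_metric phi (smooth_cst M (1 / b) *: xi)
    (fun X => smooth_cst M b * eta X)
    (fun X Y => smooth_cst M a * g X Y + smooth_cst M (b ^+ 2 - a) * (eta X * eta Y)).
Proof.
have bb : smooth_cst M b * smooth_cst M (1 / b) = 1.
  by rewrite -smooth_cstM mul1r divff ?smooth_cst1// gt_eqF.
split; split.
- exact: phiL.
- move=> f X Y; rewrite eta_add eta_scale -[RHS]/(f * _ + _); ring.
- exact: homothety_riemannian_metric.
- by move=> X; rewrite phi2 scalerA mulrAC bb mul1r.
- by rewrite eta_scale eta_xi mulr1.
- move=> X Y; rewrite !eta_phi g_phi smooth_cstB expr2 smooth_cstM; ring.
Qed.

End homothety.

(** * Covariant derivatives of [xi] and [eta] on a Sasakian manifold *)

Section sasakian.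
Variable D : vfield M -> vfield M -> vfield M.
Hypothesis D_lc : is_levi_civita g D.
Hypothesis D_phi : forall X Y, D X (phi Y) - phi (D X Y) = g X Y *: xi - eta Y *: X.

(** Differentiating g(xi, xi) = 1 shows that [D X xi] has no [xi] component, so it is determined by
    its image under [phi]. The Sasakian identity at Y = xi gives that image as - phi^2 X. *)
Lemma sasakian_nabla_xi X : D X xi = - phi X.
Proof.
have [[_ DD _] _ Dg] := D_lc.
have DX0 : D X 0 = 0 by apply: (addrI (D X 0)); rewrite -DD !addr0.
have eD : eta (D X xi) = 0.
  apply: smooth_addrr_eq0; have := Dg X xi xi.
  by rewrite !metric_xi eta_xi vfield_1 (metricC xi) metric_xi => <-.
have pD : phi (D X xi) = - phi (phi X).
  have := D_phi X xi.
  rewrite phi_xi DX0 sub0r metric_xi eta_xi scale1r phi2 => e.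
  by rewrite -[LHS]opprK e addrC.
have := phi2 (D X xi).
rewrite eD scale0r addr0 pD (linear_mapN phiL) phi2 eta_phi scale0r addr0.
by move/(congr1 -%R); rewrite !opprK => <-.
Qed.

Lemma sasakian_deriv_eta X Y : X (eta Y) = eta (D X Y) - g Y (phi X).
Proof.
have [_ _ Dg] := D_lc.
by rewrite -metric_xi Dg sasakian_nabla_xi metric_oppr metric_xi.
Qed.

(** * The Levi-Civita connection of the new metric *)

Section connection.
Variables (a b : R).
Hypothesis a0 : 0 < a.

Let k := smooth_cst M (1 - b ^+ 2 / a).

Let cst_a_k : smooth_cst M a * k = - smooth_cst M (b ^+ 2 - a).
Proof.
rewrite -smooth_cstM mulrBr mulr1 mulrCA divff ?gt_eqF// mulr1 !smooth_cstB.
by rewrite opprB.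
Qed.

Definition homothety_nabla X Y : vfield M :=
  D X Y + k *: (eta X *: phi Y + eta Y *: phi X).

Lemma homothety_nabla_levi_civita : is_levi_civita
  (fun X Y => smooth_cst M a * g X Y + smooth_cst M (b ^+ 2 - a) * (eta X * eta Y))
  homothety_nabla.
Proof.
have [[Dl Dr Df] Dt Dg] := D_lc.
split; first split.
- move=> f X Y Z; rewrite /homothety_nabla Dl eta_add eta_scale.
  rewrite (linear_mapD phiL) (linear_mapZ phiL).
  by apply: vfield_ext => h; rewrite !vfieldE; ring.
- move=> X Y Z; rewrite /homothety_nabla Dr eta_add (linear_mapD phiL).
  by apply: vfield_ext => h; rewrite !vfieldE; ring.
- move=> f X Y; rewrite /homothety_nabla Df eta_scale (linear_mapZ phiL).
  by apply: vfield_ext => h; rewrite !vfieldE; ring.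
- move=> X Y; rewrite -Dt /homothety_nabla.
  by apply: vfield_ext => h; rewrite !vfieldE; ring.
move=> X Y Z; rewrite vfield_add !vfield_mul !vfield_cst Dg !sasakian_deriv_eta.
rewrite /homothety_nabla !metric_addl !metric_addr !metric_scalel !metric_scaler.
rewrite !metric_addl !metric_addr !metric_scalel !metric_scaler.
rewrite !(eta_add, eta_scale) !eta_phi (metric_phi_skew Y Z) (metricC Z).
(* The correction terms with factor eta(X) cancel by skewness of [phi]; those with eta(Y) and eta(Z)
   balance once both coefficients are written through a k. *)
have -> : smooth_cst M (b ^+ 2 - a) = - (smooth_cst M a * k) by rewrite cst_a_k opprK.
ring.
Qed.

(** The terms k eta(X) phi^2 Y cancel and eta(phi Y) = 0, so the correction contributes only - k
    eta(Y) phi^2 X. *)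
Lemma homothety_nabla_phi X Y :
  homothety_nabla X (phi Y) - phi (homothety_nabla X Y) =
  (g X Y - k * (eta X * eta Y)) *: xi - ((1 - k) * eta Y) *: X.
Proof.
have -> : homothety_nabla X (phi Y) - phi (homothety_nabla X Y) =
    (D X (phi Y) - phi (D X Y)) - (k * eta Y) *: phi (phi X).
  rewrite /homothety_nabla eta_phi (linear_mapD phiL) (linear_mapZ phiL).
  rewrite (linear_mapD phiL) !(linear_mapZ phiL).
  by apply: vfield_ext => h; rewrite !vfieldE; ring.
rewrite D_phi phi2.
by apply: vfield_ext => h; rewrite !vfieldE; ring.
Qed.

End connection.
End sasakian.
End almost_contact_metric.

Unset Implicit Arguments.
Set Strict Implicit.
Set Printing Implicit Defensive.

Theorem corollary2 (R : realType) (n : nat) (hn : (1 <= n)%N)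
    (M : manifold R (2 * n + 1)) (hM : connected [set: M])
    (phi : vfield M -> vfield M) (xi : vfield M)
    (eta : vfield M -> smooth_fun M)
    (g : vfield M -> vfield M -> smooth_fun M)
    (alpha beta : R) (halpha : 0 < alpha) (hbeta : 0 < beta) :
  is_sasakian phi xi eta g ->
  is_c_sasakian (beta / alpha)
    phi
    (smooth_cst M (1 / beta) *: xi)
    (fun X => smooth_cst M beta * eta X)
    (fun X Y => smooth_cst M alpha * g X Y
                + smooth_cst M (beta ^+ 2 - alpha) * (eta X * eta Y)).
Proof.
move=> [_ acm [D D_lc D_phi1]].
have D_phi X Y : D X (phi Y) - phi (D X Y) = g X Y *: xi - eta Y *: X.
  by rewrite D_phi1 smooth_cst1 scale1r.
have aN0 : alpha != 0 by rewrite gt_eqF.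
have bN0 : beta != 0 by rewrite gt_eqF.
split; first by rewrite gt_eqF// divr_gt0.
  exact: homothety_almost_contact_metric.
exists (homothety_nabla phi eta D alpha beta).
  exact: (homothety_nabla_levi_civita acm D_lc D_phi beta halpha).
move=> X Y; rewrite (homothety_nabla_phi acm D_phi).
(* With k = 1 - beta^2 / alpha, the next three identities match the coefficients of g(X,Y) xi,
   eta(X) eta(Y) xi and eta(Y) X. *)
have ca : smooth_cst M (beta / alpha) * (smooth_cst M (1 / beta) * smooth_cst M alpha) = 1.
  by rewrite -!smooth_cstM -smooth_cst1; congr smooth_cst; field; rewrite ?aN0 ?bN0.
have cb : smooth_cst M (beta / alpha) *
    (smooth_cst M (1 / beta) * smooth_cst M (beta ^+ 2 - alpha)) =
    - smooth_cst M (1 - beta ^+ 2 / alpha).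
  rewrite -!smooth_cstM -[RHS]sub0r (_ : 0 = smooth_cst M 0); last exact: val_inj.
  by rewrite -smooth_cstB; congr smooth_cst; field; rewrite ?aN0 ?bN0.
have cc : smooth_cst M (beta / alpha) * smooth_cst M beta =
    1 - smooth_cst M (1 - beta ^+ 2 / alpha).
  by rewrite -smooth_cst1 -smooth_cstB -smooth_cstM; congr smooth_cst; field; rewrite ?aN0 ?bN0.
(* The explicit factor 1 is there for [ca] to replace. The rewriting starts with [cc], whose right
   side contains those of [ca] and [cb]. *)
have -> : g X Y - smooth_cst M (1 - beta ^+ 2 / alpha) * (eta X * eta Y) =
    1 * g X Y + - smooth_cst M (1 - beta ^+ 2 / alpha) * (eta X * eta Y) by ring.
by rewrite -cc -ca -cb; apply: vfield_ext => h; rewrite !vfieldE; ring.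
Qed.
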